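(* Let $g:\mathbb{Z}^2\to\mathbb{R}$ satisfy $$g(t)=\rho(Bt)^{-1}\big(L(Bt)+o(1)\big),\quad|t|\to\infty,$$ where $B=(b_{ij})_{i,j=1,2}$ is a real nondegenerate $2\times2$ matrix, $\rho(t):=|t_1|^{q_1}+|t_2|^{q_2}$, $t\in\mathbb{R}^2$, with $q_1,q_2>0$, and $L:\mathbb{R}^2_0\to\mathbb{R}$ is of the form $$L(u)=L_+\big(u_1/\rho(u)^{1/q_1}\big)\mathbf 1(u_2\ge0)+L_-\big(u_1/\rho(u)^{1/q_1}\big)\mathbf 1(u_2<0),\quad u\in\mathbb{R}^2_0,$$ with $L_\pm:[-1,1]\to\mathbb{R}$ continuous, $L_+(1)=L_-(1)$, $L_+(-1)=L_-(-1)$. In addition: (i) let $q_1<q_2$ and $|L_+(1)|=|L_-(1)|>0$, $|L_+(-1)|=|L_-(-1)|>0$. Then the dependence axis of $g$ is $\{t\in\mathbb{R}^2:\ b_{21}t_1+b_{22}t_2=0\}$; (ii) let $q_1>q_2$ and $|L_+(0)|>0$, $|L_-(0)|>0$. Then the dependence axis of $g$ is $\{t\in\mathbb{R}^2:\ b_{11}t_1+b_{12}t_2=0\}$.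
   Context: $\mathbb{R}^2_0=\mathbb{R}^2\setminus\{(0,0)\}$, $|t|=|t_1|+|t_2|$, $a\cdot t=a_1t_1+a_2t_2$, and $\lfloor t\rfloor=(\lfloor t_1\rfloor,\lfloor t_2\rfloor)$. Dependence axis: let $g:\mathbb{R}^2\to\mathbb{R}$ be measurable. A line $\{t\in\mathbb{R}^2:a\cdot t=0\}$ with $a\in\mathbb{R}^2_0$ is the dependence axis of $g$ if for all $c\in\mathbb{R}^2_0$ with $a_1c_2\neq c_1a_2$, $$\liminf_{|t|\to\infty,\ c\cdot t=0}\frac{\log(1/|g(t)|)}{\log|t|}>\limsup_{|t|\to\infty,\ a\cdot t=0}\frac{\log(1/|g(t)|)}{\log|t|}$$ (with $\log(1/0)=+\infty$). For $g:\mathbb{Z}^2\to\mathbb{R}$, a line $\{t\in\mathbb{R}^2:a\cdot t=0\}$ is the dependence axis of $g$ if it is the dependence axis of the function $t\mapsto g(\lfloor t\rfloor)$, $t\in\mathbb{R}^2$. *)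

(* Defs.v *)
From HB Require Import structures.
From mathcomp Require Import all_boot all_order all_algebra.
From mathcomp Require Import all_classical all_reals all_analysis.
Set Implicit Arguments.
Unset Strict Implicit.
Unset Printing Implicit Defensive.
Import Order.TTheory GRing.Theory Num.Theory.
Import numFieldNormedType.Exports.

Local Open Scope classical_set_scope.
Local Open Scope ring_scope.

Definition norm1 {R : realType} (t : R * R) : R := `|t.1| + `|t.2|.

Definition dot {R : realType} (a t : R * R) : R := a.1 * t.1 + a.2 * t.2.

Definition line {R : realType} (a : R * R) : set (R * R) :=
  [set t | dot a t = 0].

Definition intv (R : realType) (t : int * int) : R * R := (t.1%:~R, t.2%:~R).
Arguments intv : clear implicits.

Definition floorv {R : realType} (t : R * R) : int * int :=
  (Num.floor t.1, Num.floor t.2).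

Definition mulmv {R : realType} (B : 'M[R]_2) (t : R * R) : R * R :=
  (B 0 0 * t.1 + B 0 1 * t.2, B 1 0 * t.1 + B 1 1 * t.2).

(* The filter |t| -> oo on T, where n t is the value of |t|. *)
Definition to_infty {R : realType} {T : Type} (n : T -> R) : set_system T :=
  filter_from [set: R] (fun M => [set t | M < n t]).

Global Instance to_infty_filter (R : realType) (T : Type) (n : T -> R) :
  Filter (to_infty n).
Proof.
apply: filter_from_filter; first by exists 0.
move=> M N _ _; exists (Num.max M N) => // t /=.
by rewrite gt_max => /andP[].
Qed.

Definition infty2 (R : realType) : set_system (R * R) := to_infty (@norm1 R).
Arguments infty2 : clear implicits.

Definition inftyZ2 (R : realType) : set_system (int * int) :=
  to_infty (fun t => norm1 (intv R t)).
Arguments inftyZ2 : clear implicits.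

(* Extended-real inverse and logarithm: 0^-1 = +oo and lne +oo = +oo, so that
   log (1 / 0) = +oo. *)
Definition log_rate {R : realType} (g : R * R -> R) (t : R * R) : \bar R :=
  (lne (`|g t|%:E)^-1 * ((ln (norm1 t))^-1)%:E)%E.

Definition is_dependence_axis {R : realType} (g : R * R -> R)
    (l : set (R * R)) : Prop :=
  measurable_fun setT g /\
  exists a : R * R, [/\ a != 0, l = line a &
    forall c : R * R, c != 0 -> a.1 * c.2 != c.1 * a.2 ->
      (limf_esup (log_rate g) (within (line a) (infty2 R)) <
       limf_einf (log_rate g) (within (line c) (infty2 R)))%E].

Definition is_dependence_axisZ {R : realType} (g : int * int -> R)
    (l : set (R * R)) : Prop :=
  is_dependence_axis (fun t : R * R => g (floorv t)) l.

Definition rho {R : realType} (q1 q2 : R) (t : R * R) : R :=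
  `|t.1| `^ q1 + `|t.2| `^ q2.

(* Main.v *)
Require Import Defs.
From HB Require Import structures.
From mathcomp Require Import all_boot all_order all_algebra.
From mathcomp Require Import all_classical all_reals all_analysis.
From mathcomp Require Import lra ring.

Import Order.TTheory GRing.Theory Num.Theory.
Import numFieldNormedType.Exports.
Local Open Scope classical_set_scope.
Local Open Scope ring_scope.

(** The decay of [g] along a line is governed by the slower-growing or the
    faster-growing term of [rho], according to the direction of the line.

    Write [B t = (s . t, r . t)] or [(r . t, s . t)], where [r] is the row of
    [B] attached to the larger exponent [q] and [s] is the row attached to the
    smaller exponent [p].  Rounding [t] to [floor t] moves [r . t] and [s . t]
    by a bounded amount only.

    - On the line [r . t = 0] the number [r . floor t] stays bounded, while
      [s . floor t] is of exact order [|t|] because [r] and [s] are linearly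
      independent.  Hence [rho (B floor t)] is of order [|t|^p], and
      the share of the [r]-term in [rho (B floor t)] tends to zero
      ([cvg_axis_rho]).  In terms of the argument [x = u_1 / rho(u)^(1/q_1)] of
      the profiles this says that [|x|^q_1] tends to 1 when [q_1 < q_2] and to 0
      when [q_2 < q_1].  There the profiles are continuous and nonzero, so
      [|L + o(1)|] is bounded below and [|g| >= c |t|^-p]: the limsup of the decay rate is at most [p].
    - On any other line [r . floor t] is of order at least [|t|], so that
      [rho (B floor t) >= c |t|^q].  The profiles are bounded, being continuous
      on a segment, so [|g| <= C |t|^-q]: the liminf of the decay rate is at
      least [q].

    The two halves are joined in [rho_dependence_axis], where the numerator
    [L + o(1)] is an arbitrary function with these two bounds; both parts of
    the theorem are instances of it, with the two rows of [B] exchanged. *)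

Set Implicit Arguments.
Unset Strict Implicit.
Unset Printing Implicit Defensive.

(** * Decay rates at infinity *)

Implicit Types (R : realType).

Lemma log_rate_neq0 R (G : R * R -> R) t : G t != 0 ->
  log_rate G t = (- ln `|G t| / ln (norm1 t))%:E.
Proof.
move=> G0; rewrite /log_rate inver normr_eq0 (negbTE G0).
by rewrite lne_EFin ?invr_gt0 ?normr_gt0// lnV ?posrE ?normr_gt0.
Qed.

Lemma log_rate_eq0 R (G : R * R -> R) t : G t = 0 -> 1 < norm1 t ->
  log_rate G t = +oo%E.
Proof.
move=> G0 t1; rewrite /log_rate G0 normr0 inve0 /= gt0_mulye//.
by rewrite lte_fin invr_gt0 ln_gt0.
Qed.

Lemma near_infty2 R (M : R) : \forall t \near infty2 R, M < norm1 t.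
Proof. by exists M. Qed.

#[local] Instance infty2_filter R : Filter (infty2 R).
Proof. exact: to_infty_filter. Qed.

Lemma near_within_infty2 R (A : set (R * R)) (M : R) :
  \forall t \near within A (infty2 R), M < norm1 t.
Proof. by apply: cvg_within; exact: near_infty2. Qed.

(** A multiplicative constant does not affect the rate: it contributes
    [ln C / ln |t|], which tends to zero.  The same holds for the lower bound
    on the liminf below. *)
Lemma limf_esup_log_rate_le R (G : R * R -> R) (A : set (R * R)) (C p : R) :
  0 < C ->
  (\forall t \near within A (infty2 R), C * norm1 t `^ (- p) <= `|G t|) ->
  (limf_esup (log_rate G) (within A (infty2 R)) <= p%:E)%E.
Proof.
move=> C0 CG; apply/lee_addgt0Pr => e e0; rewrite limf_esupE.
pose V := [set t | (log_rate G t <= (p + e)%:E)%E].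
suff FV : within A (infty2 R) V.
  apply: (@le_trans _ _ (ereal_sup (log_rate G @` V))).
    by apply: ereal_inf_lbound => /=; exists V.
  by apply: ge_ereal_sup => _ [t Vt <-].
near=> t; rewrite /V /=.
have t1 : 1 < norm1 t by near: t; exact: near_within_infty2.
have h : C * norm1 t `^ (- p) <= `|G t| by near: t.
(* beyond this threshold the error term [ln C / ln |t|] is at most [e] *)
have te : expR (`|ln C| / e) < norm1 t by near: t; exact: near_within_infty2.
have lt0 : 0 < ln (norm1 t) by rewrite ln_gt0.
have N0 : 0 < norm1 t by rewrite (lt_trans _ t1).
have P0 : 0 < C * norm1 t `^ (- p) by rewrite mulr_gt0// powR_gt0.
have Gt0 : 0 < `|G t| by exact: lt_le_trans h.
rewrite log_rate_neq0 -?normr_gt0// lee_fin ler_pdivrMr//.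
move: h; rewrite -ler_ln ?posrE// lnM ?posrE ?powR_gt0// ln_powR => h.
have {}te : `|ln C| < e * ln (norm1 t).
  by rewrite mulrC -ltr_pdivrMr// -ltr_expR lnK.
have := ler_norm (- ln C); rewrite normrN => lC.
by rewrite mulrDl lerNl; move: h lC te; lra.
Unshelve. all: by end_near. Qed.

Lemma limf_einf_log_rate_ge R (G : R * R -> R) (A : set (R * R)) (C q : R) :
  0 < C ->
  (\forall t \near within A (infty2 R), `|G t| <= C * norm1 t `^ (- q)) ->
  (q%:E <= limf_einf (log_rate G) (within A (infty2 R)))%E.
Proof.
move=> C0 CG; apply/lee_subgt0Pr => e e0; rewrite limf_einfE.
pose V := [set t | ((q - e)%:E <= log_rate G t)%E].
suff FV : within A (infty2 R) V.
  apply: (@le_trans _ _ (ereal_inf (log_rate G @` V))).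
    by apply: le_ereal_inf_tmp => _ [t Vt <-].
  by apply: ereal_sup_ubound => /=; exists V.
near=> t; rewrite /V /=.
have t1 : 1 < norm1 t by near: t; exact: near_within_infty2.
have h : `|G t| <= C * norm1 t `^ (- q) by near: t.
have te : expR (`|ln C| / e) < norm1 t by near: t; exact: near_within_infty2.
have [G0|Gt0] := eqVneq (G t) 0; first by rewrite log_rate_eq0// leey.
have lt0 : 0 < ln (norm1 t) by rewrite ln_gt0.
have N0 : 0 < norm1 t by rewrite (lt_trans _ t1).
rewrite log_rate_neq0// lee_fin ler_pdivlMr//.
move: h; rewrite -ler_ln ?posrE ?mulr_gt0 ?powR_gt0 ?normr_gt0//.
rewrite lnM ?posrE ?powR_gt0// ln_powR => h.
have {}te : `|ln C| < e * ln (norm1 t).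
  by rewrite mulrC -ltr_pdivrMr// -ltr_expR lnK.
have := ler_norm (ln C) => lC.
by rewrite mulrBl lerNr; move: h lC te; lra.
Unshelve. all: by end_near. Qed.

(** * Measurability *)

(** [floorv] has countably many values, and its fibres are products of
    half-open intervals, so any function of [floorv t] is measurable. *)
Lemma measurable_comp_floorv R (g : int * int -> R) :
  measurable_fun setT (fun t : R * R => g (floorv t)).
Proof.
move=> _ Y _; rewrite setTI.
have -> : (fun t : R * R => g (floorv t)) @^-1` Y =
    \bigcup_(k : int * int) [set t : R * R | floorv t = k /\ Y (g k)].
  apply/seteqP; split => [t Yt|t [k _ [<-]]//].
  by exists (floorv t).
apply: countable_bigcupT_measurable => [|k]; first exact: countableP.
have [Yk|nYk] := pselect (Y (g k)); last first.
  rewrite (_ : [set _ | _] = set0)//.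
  by apply/seteqP; split => // t [].
rewrite (_ : [set _ | _] =
  `[k.1%:~R, (k.1 + 1)%:~R[%classic `*` `[k.2%:~R, (k.2 + 1)%:~R[%classic).
  by apply: measurableX; exact: measurable_itv.
apply/seteqP; split => [t [<- _]|t [/= h1 h2]].
  by split; rewrite /= in_itv /= floor_itv.
split => //; rewrite /floorv (surjective_pairing k).
by move: h1 h2; rewrite !in_itv /= => /floor_def -> /floor_def ->.
Qed.

(** * Linear forms at integer parts *)

Lemma norm1_ge0 R (t : R * R) : 0 <= norm1 t.
Proof. by rewrite addr_ge0. Qed.

Lemma dot_le_norm1 R (a t : R * R) : `|dot a t| <= norm1 a * norm1 t.
Proof.
rewrite (le_trans (ler_normD _ _))// !normrM /norm1.
have := (normr_ge0 a.1, normr_ge0 a.2, normr_ge0 t.1, normr_ge0 t.2).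
by move=> [[[]]]; nra.
Qed.

Lemma dist_dot_floorv R (a t : R * R) :
  `|dot a t - dot a (intv R (floorv t))| <= norm1 a.
Proof.
have frac (x : R) : `|x - (Num.floor x)%:~R| <= 1.
  by have /andP[] := floor_itv x; rewrite intrD ler_norml; lra.
rewrite /dot /= opprD addrACA -!mulrBr (le_trans (ler_normD _ _))// !normrM.
by rewrite lerD// ler_piMr.
Qed.

Lemma norm1_intv_floorv R (t : R * R) :
  norm1 t <= norm1 (intv R (floorv t)) + 2.
Proof.
have frac (x : R) : `|x| <= `|(Num.floor x)%:~R : R| + 1.
  rewrite -lerBlDl (le_trans (lerB_dist _ _))//.
  by have /andP[] := floor_itv x; rewrite intrD ler_norml; lra.
by have := lerD (frac t.1) (frac t.2); rewrite /norm1 /=; lra.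
Qed.

Lemma cvg_floorv R : @floorv R t @[t --> infty2 R] --> inftyZ2 R.
Proof.
move=> P [M _ MP]; exists (M + 2) => // t /= Mt; apply: MP => /=.
by have := norm1_intv_floorv t; lra.
Qed.

(** By Cramer's rule, both coordinates of [t], multiplied by the determinant of
    the rows [a] and [c], are combinations of [dot a t] and [dot c t]; the
    second form vanishes on the line. *)
Lemma transverse_dot_ge R (a c : R * R) : a.1 * c.2 != c.1 * a.2 ->
  exists2 K, 0 < K & forall t, line c t -> K * norm1 t <= `|dot a t|.
Proof.
rewrite -subr_eq0; set D := _ - _ => D0.
have c0 : 0 < norm1 c.
  rewrite lt0r norm1_ge0 andbT; apply: contra D0; rewrite /norm1 /D.
  by rewrite paddr_eq0// !normr_eq0 => /andP[/eqP-> /eqP->]; rewrite mulr0 mul0r subrr.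
exists (`|D| / norm1 c) => [|t ct]; first by rewrite divr_gt0 ?normr_gt0.
rewrite mulrAC ler_pdivrMr// {1}/norm1 mulrDr -!normrM.
have -> : D * t.1 = dot a t * c.2 - a.2 * dot c t by rewrite /D /dot; ring.
have -> : D * t.2 = a.1 * dot c t - c.1 * dot a t by rewrite /D /dot; ring.
rewrite ct !mulr0 subr0 sub0r normrN !normrM /norm1; lra.
Qed.

(** The linear lower bound survives rounding, at the cost of half the constant,
    because rounding changes [dot a t] by at most [norm1 a]. *)
Lemma near_transverse_floorv R (a c : R * R) : a.1 * c.2 != c.1 * a.2 ->
  exists2 K, 0 < K & \forall t \near within (line c) (infty2 R),
    K * norm1 t <= `|dot a (intv R (floorv t))|.
Proof.
move=> /transverse_dot_ge[K K0 aK]; exists (K / 2); first by rewrite divr_gt0.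
near=> t.
have ct : line c t by near: t; exact: withinT.
have tl : norm1 a / (K / 2) < norm1 t by near: t; exact: near_within_infty2.
move: tl; rewrite ltr_pdivrMr ?divr_gt0// => tl.
have := lerB_dist (dot a t) (dot a t - dot a (intv R (floorv t))).
rewrite subKr; have := dist_dot_floorv a t; have := aK _ ct; lra.
Unshelve. all: by end_near. Qed.

Lemma near_dot_floorv_le R (a : R * R) (A : set (R * R)) :
  \forall t \near within A (infty2 R),
    `|dot a (intv R (floorv t))| <= 2 * norm1 a * norm1 t.
Proof.
near=> t; have t1 : 1 < norm1 t by near: t; exact: near_within_infty2.
have := lerB_dist (dot a (intv R (floorv t))) (dot a t).
rewrite distrC; have := dist_dot_floorv a t; have := dot_le_norm1 a t.
have := norm1_ge0 a; nra.
Unshelve. all: by end_near. Qed.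

Lemma dot_floorv_line R (a t : R * R) : line a t ->
  `|dot a (intv R (floorv t))| <= norm1 a.
Proof.
by move=> at0; have := dist_dot_floorv a t; rewrite at0 sub0r normrN.
Qed.

(** * Growth of rho along lines *)

Lemma ler_powR2 R (p x y : R) : 0 < p -> 0 <= x -> x <= y -> x `^ p <= y `^ p.
Proof.
move=> p0 x0 xy; apply: ge0_ler_powR; rewrite ?nnegrE ?(ltW p0)//.
exact: le_trans xy.
Qed.

(** Since powers of [norm1 t] with positive exponent are unbounded, this is how
    bounded quantities are absorbed far away. *)
Lemma near_powR_norm1 R (A : set (R * R)) (K p M : R) : 0 < K -> 0 < p ->
  \forall t \near within A (infty2 R), M <= (K * norm1 t) `^ p.
Proof.
move=> K0 p0; near=> t.
have tM : (`|M| `^ p^-1) / K < norm1 t by near: t; exact: near_within_infty2.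
rewrite (le_trans (ler_norm M))//.
rewrite -[leLHS](@powRr1 R)// -(mulVf (lt0r_neq0 p0)) powRrM.
by rewrite ler_powR2 ?powR_ge0// mulrC -ler_pdivrMr// ltW.
Unshelve. all: by end_near. Qed.

(** On the line of [r] the second term is bounded, whatever [q] is, so it is
    absorbed by the order of growth of the first. *)
Lemma near_axis_rho_le R (r s : R * R) (p q : R) : 0 < p -> 0 < q ->
  exists2 C, 0 < C & \forall t \near within (line r) (infty2 R),
    `|dot s (intv R (floorv t))| `^ p + `|dot r (intv R (floorv t))| `^ q
    <= C * norm1 t `^ p.
Proof.
move=> p0 q0; exists ((2 * norm1 s) `^ p + norm1 r `^ q + 1).
  by have := powR_ge0 (2 * norm1 s) p; have := powR_ge0 (norm1 r) q; lra.
near=> t; have rt : line r t by near: t; exact: withinT.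
have : 1 <= (1 * norm1 t) `^ p by near: t; exact: near_powR_norm1.
have : `|dot r (intv R (floorv t))| `^ q <= norm1 r `^ q.
  by rewrite ler_powR2// dot_floorv_line.
have : `|dot s (intv R (floorv t))| `^ p <= (2 * norm1 s) `^ p * norm1 t `^ p.
  rewrite -powRM ?norm1_ge0 ?mulr_ge0 ?norm1_ge0// ler_powR2//.
  by near: t; exact: near_dot_floorv_le.
by move: (powR_ge0 (norm1 r) q); rewrite mul1r; nra.
Unshelve. all: by end_near. Qed.

(** On the line of [r] the second term is bounded while the first tends to
    infinity, so its share of the sum vanishes. *)
Lemma cvg_axis_rho R (r s : R * R) (p q : R) : 0 < p -> 0 < q ->
  s.1 * r.2 != r.1 * s.2 ->
  `|dot r (intv R (floorv t))| `^ q /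
    (`|dot s (intv R (floorv t))| `^ p + `|dot r (intv R (floorv t))| `^ q)
    @[t --> within (line r) (infty2 R)] --> (0 : R).
Proof.
move=> p0 q0 sr; have [K K0 sK] := near_transverse_floorv sr.
apply/cvgrPdist_le => d d0; near=> t.
have rt : line r t by near: t; exact: withinT.
have t1 : 1 < norm1 t by near: t; exact: near_within_infty2.
have : norm1 r `^ q / d <= (K * norm1 t) `^ p.
  by near: t; exact: near_powR_norm1.
rewrite ler_pdivrMr// => rK.
have sKt : K * norm1 t <= `|dot s (intv R (floorv t))| by near: t.
have v_le : `|dot r (intv R (floorv t))| `^ q <= norm1 r `^ q.
  by rewrite ler_powR2// dot_floorv_line.
have Kt0 : 0 < K * norm1 t by rewrite mulr_gt0// (lt_trans _ t1).
have : (K * norm1 t) `^ p <= `|dot s (intv R (floorv t))| `^ p.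
  by rewrite ler_powR2// ltW.
have := powR_gt0 p Kt0; have := powR_ge0 `|dot r (intv R (floorv t))| q.
move: v_le rK; set v := `|dot r _| `^ q; set u := `|dot s _| `^ p => *.
have uv0 : 0 < u + v by lra.
rewrite sub0r normrN ger0_norm ?divr_ge0 ?(ltW uv0)//.
by rewrite ler_pdivrMr//; nra.
Unshelve. all: by end_near. Qed.

(** The strict inequality [p < q] separates the two rates: at most [p] on the
    line of [r], where the numerator is bounded below and the denominator is of
    order [|t|^p], and at least [q] on every other line, where the numerator is
    bounded above and the [r]-term alone makes the denominator of order at least
    [|t|^q]. *)
Lemma rho_dependence_axis R (g : int * int -> R) (h : R * R -> R)
    (r s : R * R) (p q : R) :
  0 < p -> 0 < q -> p < q -> s.1 * r.2 != r.1 * s.2 ->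
  (\forall t \near infty2 R, `|g (floorv t)| = `|h t| /
     (`|dot s (intv R (floorv t))| `^ p + `|dot r (intv R (floorv t))| `^ q)) ->
  (exists M, \forall t \near infty2 R, `|h t| <= M) ->
  (exists2 m, 0 < m & \forall t \near within (line r) (infty2 R), m <= `|h t|) ->
  is_dependence_axisZ g (line r).
Proof.
move=> p0 q0 pq sr gE [M hM] [m m0 hm]; split.
  exact: measurable_comp_floorv.
exists r; split => // [|c c0 rc].
  by apply: contra sr => /eqP ->; rewrite mulr0 mul0r.
apply: (@le_lt_trans _ _ p%:E); last apply: (@lt_le_trans _ _ q%:E).
- have [C C0 hC] := near_axis_rho_le r s p0 q0.
  apply: (@limf_esup_log_rate_le _ _ _ (m / C)); first exact: divr_gt0.
  have [K K0 sK] := near_transverse_floorv sr.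
  near=> t.
  have t1 : 1 < norm1 t by near: t; exact: near_within_infty2.
  have -> : `|g (floorv t)| = `|h t| / (`|dot s (intv R (floorv t))| `^ p +
      `|dot r (intv R (floorv t))| `^ q) by near: t; exact: cvg_within.
  have : `|dot s (intv R (floorv t))| `^ p + `|dot r (intv R (floorv t))| `^ q
      <= C * norm1 t `^ p by near: t.
  have sK1 : K * norm1 t <= `|dot s (intv R (floorv t))| by near: t.
  set D := _ + _ => DC.
  have D0 : 0 < D.
    rewrite ltr_pwDl ?powR_ge0// powR_gt0//.
    by rewrite (lt_le_trans _ sK1)// mulr_gt0// (lt_trans _ t1).
  have mh : m <= `|h t| by near: t.
  rewrite powRN -mulrA -invfM ler_pM ?(ltW m0)//.
    by rewrite invr_ge0 (le_trans (ltW D0)).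
  by rewrite lef_pV2// posrE (lt_le_trans D0).
- by rewrite lte_fin.
- have [K K0 rK] := near_transverse_floorv rc.
  have Kq : 0 < K `^ q by rewrite powR_gt0.
  apply: (@limf_einf_log_rate_ge _ _ _ ((`|M| + 1) / K `^ q)).
    by rewrite divr_gt0// ltr_wpDl.
  near=> t.
  have t1 : 1 < norm1 t by near: t; exact: near_within_infty2.
  have -> : `|g (floorv t)| = `|h t| / (`|dot s (intv R (floorv t))| `^ p +
      `|dot r (intv R (floorv t))| `^ q) by near: t; exact: cvg_within.
  have rK1 : K * norm1 t <= `|dot r (intv R (floorv t))| by near: t.
  set D := _ + _.
  have t0 : 0 < norm1 t by rewrite (lt_trans _ t1).
  have KD : K `^ q * norm1 t `^ q <= D.
    rewrite -powRM ?(ltW K0)// ?(ltW t0)// ler_wpDl ?powR_ge0//.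
    by rewrite ler_powR2 ?mulr_ge0 ?(ltW K0) ?(ltW t0).
  have P0 : 0 < K `^ q * norm1 t `^ q by rewrite mulr_gt0 ?powR_gt0.
  have hMt : `|h t| <= M by near: t; exact: cvg_within.
  rewrite powRN -mulrA -invfM ler_pM ?invr_ge0//.
  + by rewrite (le_trans (ltW P0)).
  + by rewrite (le_trans hMt)// (le_trans (ler_norm M))// lerDl.
  + by rewrite lef_pV2// posrE (lt_le_trans P0).
Unshelve. all: by end_near. Qed.

(** * Profiles and normalised points *)

Lemma continuous_itv_bounded R (f : R -> R) :
  {within `[-1, 1], continuous f} ->
  exists M, forall x, `|x| <= 1 -> `|f x| <= M.
Proof.
move=> cf; have N11 : -1 <= 1 :> R by lra.
have [a _ fa] := EVT_max N11 cf; have [b _ fb] := EVT_min N11 cf.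
exists (`|f a| + `|f b|) => x x1.
have xI : x \in `[-1, 1] by rewrite in_itv /= -ler_norml.
have := fa _ xI; have := fb _ xI.
have := ler_norm (f a); have := ler_norm (- f b).
have := (normr_ge0 (f a), normr_ge0 (f b)).
by rewrite normrN => -[] *; rewrite ler_norml; apply/andP; split; lra.
Qed.

Lemma continuous_itv_neq0 R (f : R -> R) (a : R) :
  {within `[-1, 1], continuous f} -> `|a| <= 1 -> 0 < `|f a| ->
  exists2 d, 0 < d &
    forall x, `|x| <= 1 -> `|a - x| < d -> `|f a| / 2 <= `|f x|.
Proof.
move=> /subspace_continuousP cf a1 fa0.
have aI : `[-1, 1]%classic a by rewrite /= in_itv /= -ler_norml.
have fa2 : 0 < `|f a| / 2 by rewrite divr_gt0.
have /cvgr_dist_lt/(_ _ fa2) := cf a aI.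
rewrite near_withinE => -[d /= d0 dP]; exists d => // x x1 ax.
have := dP x ax; rewrite /= in_itv /= -ler_norml => /(_ x1).
by have := lerB_dist (f a) (f x); lra.
Qed.

(** The closeness condition is on [|x| ^ q] rather than on [x] because, at
    [x = u_1 / rho(u)^(1/q)], that power is the share [|u_1|^q / rho(u)] of the
    first term in [rho(u)], which is what can be controlled. *)
Definition nonvanishing_at R (q y : R) (f : R -> R) :=
  exists d m, [/\ 0 < d, 0 < m &
    forall x, `|x| <= 1 -> `|y - `|x| `^ q| < d -> m <= `|f x|].

(** [|x| ^ q] close to 1 forces [x] to be close to 1 or to -1; both endpoints
    are needed because the sign of [x] is not determined. *)
Lemma nonvanishing_at1 R (f : R -> R) (q : R) : 0 < q ->
  {within `[-1, 1], continuous f} -> 0 < `|f 1| -> 0 < `|f (-1)| ->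
  nonvanishing_at q 1 f.
Proof.
move=> q0 cf f1 fN1.
have [|d d0 fd] := continuous_itv_neq0 cf _ f1; first by rewrite normr1.
have [|e e0 fe] := continuous_itv_neq0 cf _ fN1.
  by rewrite normrN normr1.
(* [|x|] at least [y = 1 - k / 2] places [x] within both continuity radii, and
   capping [k] at 1 keeps [y] nonnegative *)
pose k := Num.min (Num.min d e) 1.
have k0 : 0 < k by rewrite !lt_min d0 e0 ltr01.
have kd : k <= d by rewrite !ge_min lexx.
have ke : k <= e by rewrite !ge_min lexx orbT.
have k1 : k <= 1 by rewrite ge_min lexx orbT.
pose y := 1 - k / 2.
have [y0 y1 yd ye] : [/\ 0 <= y, y < 1, 1 - y < d & 1 - y < e].
  by rewrite /y; split; lra.
exists (1 - y `^ q), (Num.min (`|f 1|) (`|f (-1)|) / 2); split.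
- rewrite subr_gt0; have := @gt0_ltr_powR R q q0 y 1.
  by rewrite powR1 !nnegrE; apply.
- by rewrite divr_gt0// lt_min f1.
move=> x x1; rewrite ltr_distlC subKr => /andP[yx _].
have {}yx : y <= `|x|.
  rewrite leNgt; apply/negP => xy; move: yx; rewrite ltNge => /negP; apply.
  by apply/ltW/gt0_ltr_powR => //; rewrite nnegrE.
have [x0|x0] := leP 0 x.
  move: x1 yx; rewrite ger0_norm// => x1 yx.
  apply: (@le_trans _ _ (`|f 1| / 2)).
    by rewrite ler_pM2r ?invr_gt0// ge_min lexx.
  by apply: fd; rewrite ger0_norm//; lra.
move: x1 yx; rewrite ltr0_norm// => x1 yx.
apply: (@le_trans _ _ (`|f (-1)| / 2)).
  by rewrite ler_pM2r ?invr_gt0// ge_min lexx orbT.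
apply: fe; first by rewrite ltr0_norm.
by rewrite ltr_norml; lra.
Qed.

Lemma nonvanishing_at0 R (f : R -> R) (q : R) : 0 < q ->
  {within `[-1, 1], continuous f} -> 0 < `|f 0| ->
  nonvanishing_at q 0 f.
Proof.
move=> q0 cf f0.
have [|d d0 fd] := continuous_itv_neq0 cf _ f0; first by rewrite normr0.
exists ((d / 2) `^ q), (`|f 0| / 2); split.
- by rewrite powR_gt0 ?divr_gt0.
- by rewrite divr_gt0.
move=> x x1 xd; apply: fd => //; rewrite sub0r normrN ltNge; apply/negP => dx.
move: xd; rewrite sub0r normrN ger0_norm ?powR_ge0// ltNge => /negP; apply.
by apply/ltW; apply: gt0_ltr_powR; rewrite ?nnegrE//; lra.
Qed.

Lemma rho_gt0 R (q1 q2 : R) (u : R * R) : u != 0 -> 0 < rho q1 q2 u.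
Proof.
move=> u0; rewrite /rho lt0r addr_ge0 ?powR_ge0// andbT.
apply: contra u0; rewrite paddr_eq0 ?powR_ge0// => /andP[/eqP h1 /eqP h2].
case: u h1 h2 => x y /= /powR_eq0_eq0/normr0_eq0-> /powR_eq0_eq0/normr0_eq0->.
by [].
Qed.

Lemma rho_normalized R (q1 q2 : R) (u : R * R) : 0 < q1 -> u != 0 ->
  `|u.1 / rho q1 q2 u `^ q1^-1| `^ q1 = `|u.1| `^ q1 / rho q1 q2 u.
Proof.
move=> q10 u0; have r0 := rho_gt0 q1 q2 u0.
rewrite normrM powRM// normfV (ger0_norm (powR_ge0 _ _)).
by rewrite -powRN -powRrM mulNr mulVf ?gt_eqF// powR_inv1// ltW.
Qed.

(** By the previous identity the [q1]-th power is the share of one of the two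
    terms of [rho], so it is at most 1; hence the profiles are only evaluated on
    the segment where they are continuous. *)
Lemma rho_normalized_le1 R (q1 q2 : R) (u : R * R) : 0 < q1 -> u != 0 ->
  `|u.1 / rho q1 q2 u `^ q1^-1| <= 1.
Proof.
move=> q10 u0; have r0 := rho_gt0 q1 q2 u0.
have := rho_normalized q2 q10 u0; set x := _ / _ => xq.
rewrite leNgt; apply/negP => x1.
have := @gt0_ltr_powR R q1 q10 1 `|x|.
rewrite powR1 !nnegrE xq => /(_ ler01 (normr_ge0 _) x1).
by rewrite ltr_pdivlMr// mul1r /rho ltNge lerDl powR_ge0.
Qed.

Lemma unitmx2_det R (B : 'M[R]_2) : B \in unitmx ->
  B 0 0 * B 1 1 != B 1 0 * B 0 1.
Proof.
rewrite unitmxE unitfE; apply: contra => /eqP h.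
have l1 : lift 0 0 = 1 :> 'I_2 by exact/val_inj.
have l0 : lift (lift 0 0) 0 = 0 :> 'I_2 by exact/val_inj.
rewrite (expand_det_row _ 0) !big_ord_recl big_ord0 /cofactor !det_mx11 !mxE /=.
rewrite l0 !l1 /bump /= addn0 expr0 expr1 mul1r addr0 mulN1r mulrN h.
by rewrite mulrC subrr.
Qed.

(** The side of the axis on which [u] lies only selects the profile; estimates
    uniform in both profiles need no further information on it. *)
Lemma profile_dichotomy R (q1 q2 : R) (L : R * R -> R) (Lp Lm : R -> R) :
  (forall u : R * R, u != 0 ->
    L u = Lp (u.1 / rho q1 q2 u `^ q1^-1) * \1_[set v : R * R | 0 <= v.2] u
        + Lm (u.1 / rho q1 q2 u `^ q1^-1) * \1_[set v : R * R | v.2 < 0] u) ->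
  forall u, u != 0 -> let x := u.1 / rho q1 q2 u `^ q1^-1 in
    L u = Lp x \/ L u = Lm x.
Proof.
move=> hL u u0 x; rewrite hL// -/x !indicE.
have [h|h] := leP 0 u.2; [left|right].
  rewrite mem_set//= memNset/= ?mulr1 ?mulr0 ?addr0//.
  by apply/negP; rewrite -leNgt.
rewrite memNset/= ?mem_set ?mulr1 ?mulr0 ?add0r//=.
by apply/negP; rewrite -ltNge.
Qed.

(** * The dependence axis *)

Unset Implicit Arguments.

Theorem proposition4p4 (R : realType) (g : int * int -> R) (B : 'M[R]_2)
    (q1 q2 : R) (L : R * R -> R) (Lp Lm : R -> R)
    (hB : B \in unitmx)
    (hq1 : 0 < q1) (hq2 : 0 < q2)
    (hLp : {within `[-1, 1], continuous Lp})
    (hLm : {within `[-1, 1], continuous Lm})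
    (hL1 : Lp 1 = Lm 1) (hLN1 : Lp (-1) = Lm (-1))
    (hL : forall u : R * R, u != 0 ->
      L u = Lp (u.1 / rho q1 q2 u `^ q1^-1) * \1_[set v : R * R | 0 <= v.2] u
          + Lm (u.1 / rho q1 q2 u `^ q1^-1) * \1_[set v : R * R | v.2 < 0] u)
    (hg : exists e : int * int -> R,
      (e t @[t --> inftyZ2 R] --> (0 : R)) /\
      \forall t \near inftyZ2 R,
        g t = (rho q1 q2 (mulmv B (intv R t)))^-1
              * (L (mulmv B (intv R t)) + e t)) :
  (q1 < q2 ->
   `|Lp 1| = `|Lm 1| -> 0 < `|Lm 1| ->
   `|Lp (-1)| = `|Lm (-1)| -> 0 < `|Lm (-1)| ->
   is_dependence_axisZ g [set t : R * R | B 1 0 * t.1 + B 1 1 * t.2 = 0])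
  /\
  (q2 < q1 ->
   0 < `|Lp 0| -> 0 < `|Lm 0| ->
   is_dependence_axisZ g [set t : R * R | B 0 0 * t.1 + B 0 1 * t.2 = 0]).
Proof.
have {}hL := profile_dichotomy hL.
have detB := unitmx2_det hB.
case: hg => e [e0 gE].
pose u (t : R * R) := mulmv B (intv R (floorv t)).
pose h (t : R * R) := L (u t) + e (floorv t).
pose r0 := (B 0 0, B 0 1); pose r1 := (B 1 0, B 1 1).
have e_small d : 0 < d -> \forall t \near infty2 R, `|e (floorv t)| < d.
  move=> d0.
  have /cvgr_dist_lt/(_ _ d0) :=
    @cvg_comp _ _ _ floorv e _ _ _ (@cvg_floorv R) e0.
  by apply: filterS => t; rewrite sub0r normrN.
have {}gE : \forall t \near infty2 R,
    `|g (floorv t)| = `|h t| / rho q1 q2 (u t).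
  have : \forall t \near infty2 R,
      g (floorv t) = (rho q1 q2 (u t))^-1 * h t by exact: (cvg_floorv gE).
  apply: filterS => t ->.
  by rewrite mulrC normrM normfV [X in _ / X]ger0_norm// addr_ge0// powR_ge0.
have h_bounded : exists M, \forall t \near infty2 R, `|h t| <= M.
  have [Mp LpM] := continuous_itv_bounded hLp.
  have [Mm LmM] := continuous_itv_bounded hLm.
  (* [hL] says nothing about the value of [L] at the origin *)
  exists (`|Mp| + `|Mm| + `|L 0| + 1); near=> t.
  have et : `|e (floorv t)| < 1 by near: t; exact: e_small.
  rewrite (le_trans (ler_normD _ _))// lerD ?(ltW et)//.
  have [->|ut0] := eqVneq (u t) 0; first by rewrite lerDr addr_ge0.
  have x1 := rho_normalized_le1 q2 hq1 ut0.
  have := (LpM _ x1, LmM _ x1, normr_ge0 (L 0), ler_norm Mp, ler_norm Mm).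
  have := (normr_ge0 Mp, normr_ge0 Mm).
  by case: (hL _ ut0) => -> [? ?] [[[[? ?] ?] ?] ?]; lra.
have h_large (r : R * R) (y : R) :
    nonvanishing_at q1 y Lp -> nonvanishing_at q1 y Lm ->
    (\forall t \near within (line r) (infty2 R), u t != 0) ->
    `|(u t).1| `^ q1 / rho q1 q2 (u t)
      @[t --> within (line r) (infty2 R)] --> y ->
    exists2 m, 0 < m &
      \forall t \near within (line r) (infty2 R), m <= `|h t|.
  move=> [dp [mp [dp0 mp0 Lp_ge]]] [dm [mm [dm0 mm0 Lm_ge]]] u_neq0 uy.
  pose m := Num.min mp mm; have m0 : 0 < m by rewrite lt_min mp0.
  exists (m / 2); first by rewrite divr_gt0.
  near=> t.
  have ut0 : u t != 0 by near: t.
  have x1 := rho_normalized_le1 q2 hq1 ut0.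
  have et : `|e (floorv t)| < m / 2.
    by near: t; apply: cvg_within; apply: e_small; rewrite divr_gt0.
  have mL : m <= `|L (u t)|.
    rewrite ge_min; apply/orP.
    case: (hL _ ut0) => ->; [left; apply: Lp_ge|right; apply: Lm_ge] => //;
      rewrite rho_normalized//; near: t; exact: cvgr_dist_lt uy _ _.
  rewrite /h; have := lerB_dist (L (u t)) (- e (floorv t)).
  by rewrite opprK normrN; lra.
have u_neq0 (r s : R * R) : s.1 * r.2 != r.1 * s.2 ->
    (forall t, u t = 0 -> dot s (intv R (floorv t)) = 0) ->
    \forall t \near within (line r) (infty2 R), u t != 0.
  move=> sr us; have [K K0 sK] := near_transverse_floorv sr.
  near=> t; apply/eqP => /us s0.
  have t1 : 1 < norm1 t by near: t; exact: near_within_infty2.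
  have : K * norm1 t <= `|dot s (intv R (floorv t))| by near: t.
  by rewrite s0 normr0; nra.
split.
- move=> q12 _ L1 _ LN1.
  have sr : r0.1 * r1.2 != r1.1 * r0.2 by [].
  have un0 : \forall t \near within (line r1) (infty2 R), u t != 0.
    by apply: (u_neq0 _ _ sr) => t [].
  apply: (@rho_dependence_axis R g h r1 r0 _ _ hq1 hq2 q12 sr) => //.
  apply: (h_large _ 1) => //.
  + by apply: nonvanishing_at1 => //; rewrite ?hL1 ?hLN1.
  + exact: nonvanishing_at1.
  (* the shares of the two terms of [rho] add up to 1 *)
  have /(cvgB (cvg_cst (1 : R))) := cvg_axis_rho hq1 hq2 sr.
  rewrite subr0; apply: cvg_trans; apply: near_eq_cvg.
  apply: filterS un0 => t ut0.
  have rho0 := rho_gt0 q1 q2 ut0.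
  transitivity (1 - `|(u t).2| `^ q2 / rho q1 q2 (u t)) => //.
  by apply: (mulIf (lt0r_neq0 rho0));
    rewrite mulrBl !divfK ?lt0r_neq0// mul1r addrK.
- move=> q21 Lp0 Lm0.
  have sr : r1.1 * r0.2 != r0.1 * r1.2 by rewrite eq_sym.
  have un0 : \forall t \near within (line r0) (infty2 R), u t != 0.
    by apply: (u_neq0 _ _ sr) => t [].
  apply: (@rho_dependence_axis R g h r0 r1 _ _ hq2 hq1 q21 sr) => //.
    by apply: filterS gE => t ->; rewrite addrC.
  apply: (h_large _ 0) => //; [exact: nonvanishing_at0..|].
  under eq_fun do rewrite /rho addrC.
  exact: (cvg_axis_rho hq2 hq1 sr).
Unshelve. all: by end_near. Qed.
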